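(* Let $p \equiv 5 \pmod 6$ be prime and let $b \in \mathbb{F}_{p}^{*}$. Then $$\sum_{t=0}^{p-1}a_{p,\,t,\,b}^{3}= -p\left((p-2)\left(\frac{-2}{p}\right) +2p\right)\left(\frac{b}{p}\right).$$
   Context: $\mathbb{F}_p$ is the field with $p$ elements, $\mathbb{F}_p^*=\mathbb{F}_p\setminus\{0\}$, and $\left(\frac{\cdot}{p}\right)$ is the Legendre symbol modulo $p$, with $\left(\frac{0}{p}\right)=0$. For $a,b\in\mathbb{F}_p$, let $E_{a,b}$ be the curve $y^2=x^3+ax+b$ over $\mathbb{F}_p$, and define the integer $a_{p,\,a,\,b}$ by $\#E_{a,b}(\mathbb{F}_p)=p+1-a_{p,\,a,\,b}$ (points counted including the one point at infinity); equivalently $a_{p,\,a,\,b}=-\sum_{x\in\mathbb{F}_p}\left(\frac{x^3+ax+b}{p}\right)$. This formula is used for all pairs $(a,b)$, including those with $4a^3+27b^2=0$. A sum over $t=0,\dots,p-1$ is a sum over $t\in\mathbb{F}_p$. *)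

(* Defs.v *)
From mathcomp Require Export all_boot all_order all_algebra.

Set Implicit Arguments.
Unset Strict Implicit.
Unset Printing Implicit Defensive.

Import GRing.Theory Num.Theory.
Local Open Scope ring_scope.

(* 'F_p is the field with p elements only when p is prime; the definitions
   below are meant to be used under that hypothesis. *)

Definition legendre (p : nat) (x : 'F_p) : int :=
  if x == 0 then 0 else if [exists y : 'F_p, y ^+ 2 == x] then 1 else -1.

(* The F_p-points of y^2 = x^3 + a x + b; [None] is the point at infinity.
   The curve is allowed to be singular. *)
Definition curve_points (p : nat) (a b : 'F_p) : {set option ('F_p * 'F_p)} :=
  [set P | if P is Some (x, y) then y ^+ 2 == x ^+ 3 + a * x + b else true].

Definition frob_trace (p : nat) (a b : 'F_p) : int :=
  p%:Z + 1 - #|curve_points a b|%:Z.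

(* Main.v *)
Require Import Defs.
From mathcomp Require Import all_boot all_order all_algebra all_field.
From mathcomp Require Import ring zify.
Set Implicit Arguments.
Unset Strict Implicit.
Unset Printing Implicit Defensive.
Import GRing.Theory Num.Theory.
Local Open Scope ring_scope.

(** Let [chi] be the quadratic character and [A t] the sum over [x] of
    [chi (x^3 + t x + b)], so that the trace at [t] is [- A t].  The sum of
    [A t ^ 3] is a character sum in the four variables [t, x, y, z]; two
    features of this family make it elementary.

    First, let [psi] be a nontrivial additive character with Gauss sum [G].
    Writing [G * chi u] as the sum of [chi d * psi (d u)] makes the cubic
    polynomial enter additively, and summing over [t], which occurs linearly,
    imposes [d x + e y + f z = 0].  What remains is [psi] of the form
    [d x^3 + e y^3 + f z^3], homogeneous of degree 3.  Since cubing is a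
    bijection of the field, averaging over the scalings of [(x, y, z)] replaces
    the exponential sum by a count of common zeros of the two forms
    ([homogeneous_exp_sum], [moment_dual_sum]).

    Second, both forms are linear in [(d, e, f)].  Exchanging the summations,
    one fixes [(x, y, z)] and sums [chi (d e f) psi (b (d + e + f))] over the
    common kernel of two linear forms ([dual_sum]).  When they are independent,
    this kernel is the line spanned by the cross product of [(x, y, z)] and
    [(x^3, y^3, z^3)], and the sum over the line is again a Gauss sum
    ([dual_sum_cross]).  The product of the components of the cross product
    with their sum is, up to [-1] and a square,
    [(x + y) (y + z) (z + x) (x + y + z)], so in the coordinates
    [y + z, z + x, x + y] the character sum over all [(x, y, z)] is immediate
    ([sum_chi_Phi], [sum_chi_cross]); this is where [chi 2] comes from.

    The two linear forms are dependent only when [(x, y, z)] is zero or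
    proportional to one of thirteen vectors with entries in [{0, 1, -1}], which
    are evaluated one by one ([sum_degenerate], [sum_dual_sum]).  Adding up
    uses [chi (-3) = -1], another consequence of the bijectivity of cubing. *)

(** * The quadratic character of a finite field *)

Section CubicFamily.
Variable F : finFieldType.
Hypothesis two_neq0 : 2%:R != 0 :> F.

Definition chi (x : F) : algC :=
  if x == 0 then 0 else if [exists y, y ^+ 2 == x] then 1 else -1.

Local Notation q := (#|F|%:R : algC).

Lemma chi0 : chi 0 = 0.
Proof. by rewrite /chi eqxx. Qed.

Lemma chi_sq_arg x : chi (x ^+ 2) = (x != 0)%:R.
Proof.
rewrite /chi expf_eq0 /=; case: eqP => //= _.
by rewrite (_ : [exists y, _]) //; apply/existsP; exists x.
Qed.

Lemma chi1 : chi 1 = 1.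
Proof. by rewrite -(expr1n _ 2) chi_sq_arg oner_neq0. Qed.

Lemma chi_sqr x : chi x ^+ 2 = (x != 0)%:R.
Proof.
by rewrite /chi; case: eqP => _; rewrite ?expr0n //; case: ifP; rewrite ?sqrrN expr1n.
Qed.

Lemma sum_const (c : algC) : \sum_(x : F) c = q * c.
Proof. by rewrite sumr_const mulr_natl. Qed.

Lemma sum_indicator_neq0 : \sum_(x : F) (x != 0)%:R = q - 1 :> algC.
Proof.
rewrite -[q]mulr1 -sum_const (bigD1 0) //= [in RHS](bigD1 0) //= eqxx add0r.
by rewrite addrAC subrr add0r; apply: eq_bigr => x /= ->.
Qed.

Lemma sum_if_eq (a : F) (f : F -> algC) : \sum_x (x == a)%:R * f x = f a.
Proof.
rewrite (bigD1 a) //= eqxx mul1r big1 ?addr0 // => i /negPf->.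
by rewrite mul0r.
Qed.

Lemma neq_opp (x : F) : x != 0 -> x != - x.
Proof.
move=> x0; rewrite -subr_eq0 opprK -mulr2n -mulr_natl.
by rewrite mulf_neq0.
Qed.

Lemma sum_sqrt x : \sum_y (y ^+ 2 == x)%:R = 1 + chi x.
Proof.
rewrite /chi; case: (eqVneq x 0) => [->|x0].
  rewrite addr0 -[RHS](sum_if_eq 0 (fun=> 1)); apply: eq_bigr => y _.
  by rewrite expf_eq0 /= mulr1.
case: existsP => [[z /eqP zx]|no]; last first.
  rewrite subrr big1 // => y _; case: eqP => // yx.
  by case: no; exists y; apply/eqP.
have z0 : z != 0 by apply: contraNneq x0 => z0; rewrite -zx z0 expr0n.
transitivity (\sum_y ((y == z)%:R * 1 + (y == - z)%:R * 1 : algC)).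
  apply: eq_bigr => y _; rewrite -zx eqf_sqr !mulr1.
  case: eqP => [->|_] /=; first by rewrite (negPf (neq_opp z0)) addr0.
  by rewrite add0r.
by rewrite big_split /= !(sum_if_eq _ (fun=> 1)).
Qed.

Lemma sum_chi : \sum_x chi x = 0.
Proof.
have: \sum_x (1 + chi x) = q.
  under eq_bigr => x _ do rewrite -sum_sqrt.
  rewrite exchange_big /= -[RHS]mulr1 -sum_const; apply: eq_bigr => y _.
  rewrite -[RHS](sum_if_eq (y ^+ 2) (fun=> 1)); apply: eq_bigr => x _.
  by rewrite mulr1 eq_sym.
rewrite big_split /= sum_const mulr1 -[RHS]addr0; exact: addrI.
Qed.

Lemma chi_sign x : x != 0 -> chi x = 1 \/ chi x = -1.
Proof. by rewrite /chi => /negPf->; case: ifP; [left|right]. Qed.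

Lemma chi_eq1 x : (chi x == 1) = (x != 0) && [exists y, y ^+ 2 == x].
Proof.
rewrite /chi; case: (eqVneq x 0) => _ /=.
  by apply/negbTE; rewrite eq_sym oner_neq0.
case: ifP => _; first by rewrite eqxx.
by apply/negbTE; rewrite eq_sym -subr_eq0 opprK (_ : 1 + 1 = 2%:R) // pnatr_eq0.
Qed.

Lemma chiMsq a x : x != 0 -> chi (a * x ^+ 2) = chi a.
Proof.
move=> x0; rewrite /chi mulf_eq0 sqrf_eq0 (negPf x0) orbF.
suff -> : [exists y, y ^+ 2 == a * x ^+ 2] = [exists y, y ^+ 2 == a] by [].
apply/existsP/existsP => -[y /eqP e].
  by exists (y / x); rewrite expr_div_n e mulfK // sqrf_eq0.
by exists (y * x); rewrite exprMn e.
Qed.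

(** The product of two nonsquares is a square for reasons of counting: if [x] is
    a nonsquare, [chi (x z) + chi z] is nonpositive for every [z], while its sum
    over [z] is zero, so it vanishes identically. *)
Lemma chiM x y : chi (x * y) = chi x * chi y.
Proof.
have [->|x0] := eqVneq x 0; first by rewrite mul0r chi0 mul0r.
have [->|y0] := eqVneq y 0; first by rewrite mulr0 chi0 mulr0.
have [cx|cx] := chi_sign x0.
  move: (cx) => /eqP; rewrite chi_eq1 => /andP[_ /existsP[z /eqP zx]].
  rewrite -{1}zx mulrC chiMsq ?cx ?mul1r //.
  by apply: contraNneq x0 => z0; rewrite -zx z0 expr0n.
pose f z := - (chi (x * z) + chi z).
have f_ge0 z : true -> 0 <= f z.
  move=> _; have [->|z0] := eqVneq z 0; rewrite /f.
    by rewrite mulr0 chi0 addr0 oppr0.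
  have [cz|cz] := chi_sign z0.
    move: (cz) => /eqP; rewrite chi_eq1 => /andP[_ /existsP[t /eqP tz]].
    rewrite -{1}tz chiMsq ?cx ?cz ?addNr ?oppr0 //.
    by apply: contraNneq z0 => t0; rewrite -tz t0 expr0n.
  rewrite cz; case: (chi_sign (mulf_neq0 x0 z0)) => ->.
    by rewrite subrr oppr0.
  by rewrite opprD !opprK addr_ge0 ?ler01.
have: \sum_z f z = 0.
  rewrite sumrN big_split /= sum_chi addr0.
  have -> : \sum_i chi (x * i) = \sum_i chi i.
    by rewrite [RHS](reindex_inj (mulfI x0)).
  by rewrite sum_chi oppr0.
move/eqP; rewrite psumr_eq0 // => /allP /(_ y (mem_index_enum _)) /=.
rewrite /f oppr_eq0 addr_eq0 => /eqP->.
by rewrite cx mulN1r.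
Qed.

Lemma chi_inv x : chi x^-1 = chi x.
Proof.
case: (eqVneq x 0) => [->|x0]; first by rewrite invr0.
by rewrite -[in LHS](chiMsq _ x0) expr2 mulrA mulVf // mul1r.
Qed.

(** For nonzero [x] the summand is [chi (1 + s / x)], which turns the sum of a
    quadratic polynomial into a complete sum of [chi] without its value at 1. *)
Lemma sum_chi_shift s :
  \sum_x chi x * chi (x + s) = (s == 0)%:R * q - 1.
Proof.
case: (eqVneq s 0) => [->|s0].
  rewrite mul1r -sum_indicator_neq0; apply: eq_bigr => x _.
  by rewrite addr0 -expr2 chi_sqr.
rewrite mul0r add0r (bigD1 0) //= chi0 mul0r add0r.
transitivity (\sum_(x | x != 0) chi (1 + s * x^-1)).
  apply: eq_bigr => x x0.
  by rewrite -(chi_inv x) -chiM mulrDr mulVf // mulrC.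
rewrite (reindex_inj invr_inj) /=.
under eq_bigl => x do rewrite invr_eq0.
under eq_bigr => x _ do rewrite invrK.
have: \sum_x chi (1 + s * x) = 0.
  rewrite -[RHS]sum_chi [RHS](reindex_inj (addrI 1)).
  by rewrite [RHS](reindex_inj (mulfI s0)).
rewrite (bigD1 0) //= mulr0 addr0 chi1 => /eqP.
by rewrite addrC addr_eq0 => /eqP.
Qed.

Lemma sum_chi_reflect s :
  \sum_x chi x * chi (s - x) = chi (-1) * ((s == 0)%:R * q - 1).
Proof.
rewrite -[s == 0]oppr_eq0 -sum_chi_shift mulr_sumr; apply: eq_bigr => x _.
by rewrite [RHS]mulrCA -[in RHS]chiM mulN1r opprB.
Qed.

(** * The character sum over cross products *)

Hypothesis three_neq0 : 3%:R != 0 :> F.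
Hypothesis cube_inj : injective (fun x : F => x ^+ 3).

(** A square root of -3 would give a primitive cube root of unity, against the
    injectivity of cubing. *)
Lemma chi_m3 : chi (- 3%:R) = -1.
Proof.
have n30 : - 3%:R != 0 :> F by rewrite oppr_eq0.
case: (chi_sign n30) => // /eqP; rewrite chi_eq1 => /andP[_ /existsP[y /eqP yy]].
(* Twice a cube root of unity has the same cube as 2. *)
have /cube_inj y3 : (y - 1) ^+ 3 = 2%:R ^+ 3.
  have -> : (y - 1) ^+ 3 = y * y ^+ 2 - 3%:R * y ^+ 2 + 3%:R * y - 1 by ring.
  by rewrite yy; ring.
have : (2%:R * 2%:R * 3%:R : F) = 0.
  (* With y = 3, the equation y ^ 2 = -3 reads 12 = 0. *)
  have -> : (2%:R * 2%:R * 3%:R : F) = (2%:R + 1) ^+ 2 - - 3%:R by ring.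
  by rewrite -y3 subrK yy subrr.
by move/eqP; rewrite !mulf_eq0 (negPf two_neq0) (negPf three_neq0).
Qed.

Lemma chi_6 : chi 6%:R = - chi (- 2%:R).
Proof.
have -> : (6%:R : F) = - 3%:R * - 2%:R by ring.
by rewrite chiM chi_m3 mulN1r.
Qed.

Definition Phi (x y z : F) := (x + y) * (y + z) * (z + x) * (x + y + z).

Lemma PhiC12 x y z : Phi x y z = Phi y x z.
Proof. by rewrite /Phi; ring. Qed.

Lemma PhiC23 x y z : Phi x y z = Phi x z y.
Proof. by rewrite /Phi; ring. Qed.

(** With [s = x + y + z], [a = s - x] and [b = s - y], the polynomial [Phi] is
    [s a b (2 s - a - b)], quadratic in [s]. *)
Lemma sum_chi_Phi :
  \sum_x \sum_y \sum_z chi (Phi x y z) = chi (- 2%:R) * q * (q - 1).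
Proof.
transitivity (\sum_x \sum_y \sum_s chi ((x + y) * (s - x) * (s - y) * s)).
  apply: eq_bigr => x _; apply: eq_bigr => y _.
  rewrite (reindex_inj (addIr (- (x + y)))); apply: eq_bigr => s _ /=.
  by congr chi; rewrite /Phi; ring.
transitivity (\sum_s \sum_a \sum_b chi a * chi b * chi (s * (2%:R * s - (a + b)))).
  under eq_bigr => x _ do rewrite exchange_big.
  rewrite exchange_big; apply: eq_bigr => s _ /=.
  rewrite (reindex_inj (subrI s)); apply: eq_bigr => a _ /=.
  rewrite (reindex_inj (subrI s)); apply: eq_bigr => b _ /=.
  by rewrite -!chiM; congr chi; ring.
rewrite exchange_big /=; under eq_bigr => a _ do rewrite exchange_big /=.
have inner c : \sum_s chi (s * (2%:R * s - c)) = chi 2%:R * ((c == 0)%:R * q - 1).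
  rewrite -[c == 0]oppr_eq0 -sum_chi_shift [in RHS](reindex_inj (mulfI two_neq0)).
  rewrite mulr_sumr; apply: eq_bigr => s _ /=; rewrite -!chiM.
  by rewrite -[LHS](chiMsq _ two_neq0); congr chi; ring.
under eq_bigr => a _ do under eq_bigr => b _ do rewrite -mulr_sumr inner.
transitivity (\sum_a (chi 2%:R * q * chi a * chi (- a) - chi 2%:R * chi a * \sum_b chi b)).
  apply: eq_bigr => a _.
  rewrite -[chi (- a)](sum_if_eq (- a) chi) !mulr_sumr -sumrB; apply: eq_bigr => b _.
  by rewrite [a + b]addrC addr_eq0; ring.
rewrite sum_chi.
transitivity (\sum_(a : F) chi (- 2%:R) * q * (a != 0)%:R).
  by apply: eq_bigr => a _; rewrite -chi_sqr -[- a]mulN1r -(mulN1r 2%:R) !chiM; ring.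
by rewrite -mulr_sumr sum_indicator_neq0.
Qed.

Lemma sum_chi_Phi_0 :
  \sum_y \sum_z chi (Phi 0 y z) = - chi (-1) * (q - 1).
Proof.
rewrite -sum_indicator_neq0 mulr_sumr; apply: eq_bigr => y _.
transitivity (\sum_z (chi y * chi z - (z == - y)%:R * (chi y * chi z))).
  apply: eq_bigr => z _.
  have -> : Phi 0 y z = y * z * (z + y) ^+ 2 by rewrite /Phi; ring.
  by rewrite chiM chi_sq_arg chiM addr_eq0; case: eqP => _ /=; ring.
rewrite sumrB -mulr_sumr sum_chi sum_if_eq mulr0 add0r -[- y]mulN1r chiM -chi_sqr.
by ring.
Qed.

Lemma sum_chi_Phi_diag2 :
  \sum_x \sum_z (x != 0)%:R * (z != 0)%:R * chi (Phi x x z)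
  = - (1 + chi 2%:R) * (q - 1).
Proof.
rewrite -sum_indicator_neq0 mulr_sumr; apply: eq_bigr => x _.
have [->|x0] /= := eqVneq x 0.
  by rewrite mulr0 big1 // => z _; rewrite !mul0r.
transitivity (chi (2%:R * x) *
   \sum_z (chi (2%:R * x + z) - (z == 0)%:R * chi (2%:R * x + z)
           - (z == - x)%:R * chi (2%:R * x + z))).
  rewrite mulr_sumr; apply: eq_bigr => z _.
  have -> : Phi x x z = 2%:R * x * (2%:R * x + z) * (z + x) ^+ 2 by rewrite /Phi; ring.
  rewrite chiM chi_sq_arg chiM addr_eq0.
  have [->|z0] /= := eqVneq z 0; last by case: eqP => _ /=; ring.
  by rewrite eq_sym oppr_eq0 (negPf x0) /=; ring.
have shift0 : \sum_z chi (2%:R * x + z) = 0.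
  by rewrite -[RHS]sum_chi [RHS](reindex_inj (addrI (2%:R * x))).
rewrite !sumrB !(sum_if_eq _ (fun z => chi (2%:R * x + z))) shift0 addr0.
have -> : 2%:R * x - x = x by ring.
have c2 : chi 2%:R ^+ 2 = 1 by rewrite chi_sqr two_neq0.
have cx : chi x ^+ 2 = 1 by rewrite chi_sqr x0.
transitivity (- chi 2%:R ^+ 2 * chi x ^+ 2 - chi 2%:R * chi x ^+ 2).
  by rewrite chiM; ring.
by rewrite c2 cx; ring.
Qed.

Lemma sum_chi_Phi_diag3 :
  \sum_x (x != 0)%:R * chi (Phi x x x) = - chi (- 2%:R) * (q - 1).
Proof.
rewrite -chi_6 -sum_indicator_neq0 mulr_sumr; apply: eq_bigr => x _.
have [->|x0] /= := eqVneq x 0; first by rewrite mulr0 mul0r.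
have -> : Phi x x x = 6%:R * (2%:R * x ^+ 2) ^+ 2 by rewrite /Phi; ring.
by rewrite chiMsq ?mul1r ?mulr1 // mulf_neq0 // sqrf_eq0.
Qed.

Definition cross (x y : F) := x * y * (y ^+ 2 - x ^+ 2).
(** The first three factors are the components of the cross product of
    [(x, y, z)] and [(x ^ 3, y ^ 3, z ^ 3)]; the last one is a factorisation of
    the sum of these components. *)
Definition cross_prod (x y z : F) := cross y z * cross z x * cross x y *
  ((x - y) * (y - z) * (z - x) * (x + y + z)).

(** The polynomial [cross_prod x y z] is [- Phi x y z] times the square of
    [x y z (x - y) (y - z) (z - x)], so the sum is the complete one over [Phi]
    minus the triples with a zero or two equal entries.  Inclusion and exclusion
    is short because [Phi] vanishes when two of the entries are zero. *)
Lemma sum_chi_cross :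
  \sum_x \sum_y \sum_z chi (cross_prod x y z)
  = (q - 1) * (q * chi 2%:R + 3%:R + 3%:R * chi (-1) + 3%:R * chi (- 2%:R)
               - 2%:R * chi 2%:R).
Proof.
pose nz (a : F) : algC := (a != 0)%:R.
have Phi00 t : (chi (Phi 0 0 t) = 0) * (chi (Phi 0 t 0) = 0) * (chi (Phi t 0 0) = 0).
  by rewrite /Phi !(addr0, add0r, mulr0, mul0r) chi0.
transitivity (chi (-1) * \sum_x \sum_y \sum_z (chi (Phi x y z)
   - (x == 0)%:R * chi (Phi x y z) - (y == 0)%:R * chi (Phi x y z)
   - (z == 0)%:R * chi (Phi x y z)
   - (y == x)%:R * (nz x * nz z * chi (Phi x y z))
   - (z == y)%:R * (nz y * nz x * chi (Phi x y z))
   - (z == x)%:R * (nz z * nz y * chi (Phi x y z))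
   + 2%:R * ((y == x)%:R * ((z == x)%:R * (nz x * chi (Phi x y z)))))).
  rewrite mulr_sumr; apply: eq_bigr => x _; rewrite mulr_sumr; apply: eq_bigr => y _.
  rewrite mulr_sumr; apply: eq_bigr => z _.
  set lhs := chi _.
  have -> : lhs = chi (-1) *
      (nz (x * y * z * (x - y) * (y - z) * (z - x)) * chi (Phi x y z)).
    rewrite /nz -chi_sq_arg -!chiM /lhs; congr chi.
    by rewrite /cross_prod /cross /Phi; ring.
  congr (_ * _); rewrite /nz {lhs} !mulf_eq0 !subr_eq0 (eq_sym x y) (eq_sym y z).
  have [->|x0] := eqVneq x 0; have [->|y0] := eqVneq y 0;
    have [->|z0] := eqVneq z 0; rewrite ?Phi00 ?eqxx ?(eq_sym 0) ?(negPf x0)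
      ?(negPf y0) ?(negPf z0) /=; try ring.
  have [->|yx] := eqVneq y x; first by have [->|zx] /= := eqVneq z x; ring.
  have [->|zy] /= := eqVneq z y; first by rewrite (negPf yx) /=; ring.
  by have [->|zx] /= := eqVneq z x; ring.
have linear (f0 f1 f2 f3 f4 f5 f6 f7 : F -> F -> F -> algC) :
  \sum_x \sum_y \sum_z (f0 x y z - f1 x y z - f2 x y z - f3 x y z - f4 x y z
     - f5 x y z - f6 x y z + 2%:R * f7 x y z) =
  \sum_x \sum_y \sum_z f0 x y z - \sum_x \sum_y \sum_z f1 x y z
  - \sum_x \sum_y \sum_z f2 x y z - \sum_x \sum_y \sum_z f3 x y z
  - \sum_x \sum_y \sum_z f4 x y z - \sum_x \sum_y \sum_z f5 x y z
  - \sum_x \sum_y \sum_z f6 x y z + 2%:R * \sum_x \sum_y \sum_z f7 x y z.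
  rewrite mulr_sumr -!sumrB -big_split; apply: eq_bigr => x _ /=.
  rewrite mulr_sumr -!sumrB -big_split; apply: eq_bigr => y _ /=.
  by rewrite mulr_sumr -!sumrB -big_split; apply: eq_bigr => z _ /=.
rewrite linear {linear} sum_chi_Phi.
have S1 : \sum_x \sum_y \sum_z (x == 0)%:R * chi (Phi x y z) = - chi (-1) * (q - 1).
  rewrite -sum_chi_Phi_0 -[RHS](sum_if_eq 0 (fun x => \sum_y \sum_z chi (Phi x y z))).
  apply: eq_bigr => x _; rewrite mulr_sumr; apply: eq_bigr => y _.
  by rewrite mulr_sumr.
have S2 : \sum_x \sum_y \sum_z (y == 0)%:R * chi (Phi x y z) = - chi (-1) * (q - 1).
  rewrite exchange_big /= -S1; apply: eq_bigr => y _; apply: eq_bigr => x _.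
  by apply: eq_bigr => z _; rewrite PhiC12.
have S3 : \sum_x \sum_y \sum_z (z == 0)%:R * chi (Phi x y z) = - chi (-1) * (q - 1).
  rewrite -S2; apply: eq_bigr => x _; rewrite exchange_big /=.
  by apply: eq_bigr => z _; apply: eq_bigr => y _; rewrite PhiC23.
have S4 : \sum_x \sum_y \sum_z (y == x)%:R * (nz x * nz z * chi (Phi x y z))
    = - (1 + chi 2%:R) * (q - 1).
  rewrite -sum_chi_Phi_diag2; apply: eq_bigr => x _.
  by rewrite exchange_big /=; apply: eq_bigr => z _; rewrite sum_if_eq.
have S5 : \sum_x \sum_y \sum_z (z == y)%:R * (nz y * nz x * chi (Phi x y z))
    = - (1 + chi 2%:R) * (q - 1).
  rewrite -sum_chi_Phi_diag2 exchange_big /=; apply: eq_bigr => y _.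
  apply: eq_bigr => x _; rewrite sum_if_eq.
  by rewrite PhiC12 PhiC23.
have S6 : \sum_x \sum_y \sum_z (z == x)%:R * (nz z * nz y * chi (Phi x y z))
    = - (1 + chi 2%:R) * (q - 1).
  rewrite -sum_chi_Phi_diag2; apply: eq_bigr => x _; apply: eq_bigr => y _.
  by rewrite (sum_if_eq x (fun z => nz z * nz y * chi (Phi x y z))) PhiC23.
have S7 : \sum_x \sum_y \sum_z (y == x)%:R * ((z == x)%:R * (nz x * chi (Phi x y z)))
    = - chi (- 2%:R) * (q - 1).
  rewrite -sum_chi_Phi_diag3; apply: eq_bigr => x _.
  rewrite exchange_big /=.
  under eq_bigr => z _ do
    rewrite (sum_if_eq x (fun y => (z == x)%:R * (nz x * chi (Phi x y z)))).
  by rewrite sum_if_eq.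
rewrite S1 S2 S3 S4 S5 S6 S7.
have c1 : chi (-1) ^+ 2 = 1 by rewrite chi_sqr oppr_eq0 oner_neq0.
have c2 : chi (- 2%:R) = chi (-1) * chi 2%:R by rewrite -chiM mulN1r.
set s := chi (-1) in c1 c2 *; set t := chi 2%:R in c2 *; rewrite c2.
transitivity ((q - 1) * (s ^+ 2 * (t * q) + 3%:R * s ^+ 2
   + 3%:R * s * (1 + t) - 2%:R * s ^+ 2 * t)).
  by ring.
by rewrite c1; ring.
Qed.

(** * Gauss sums and the exchange of summations *)

Variable psi : F -> algC.
Hypothesis psiD : {morph psi : x y / x + y >-> x * y}.
Hypothesis sum_psi : forall c, \sum_x psi (c * x) = (c == 0)%:R * q.

Lemma q_neq0 : q != 0.
Proof. by rewrite pnatr_eq0 -lt0n; apply/card_gt0P; exists 0. Qed.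

Lemma psi0 : psi 0 = 1.
Proof.
have := sum_psi 0; rewrite eqxx mul1r.
under eq_bigr => x _ do rewrite mul0r.
by rewrite sum_const -[RHS]mulr1; exact: (mulfI q_neq0).
Qed.

Definition gauss := \sum_x chi x * psi x.

Lemma gauss_twist c : \sum_x chi x * psi (c * x) = chi c * gauss.
Proof.
have [->|c0] := eqVneq c 0.
  under eq_bigr => x _ do rewrite mul0r psi0 mulr1.
  by rewrite chi0 mul0r sum_chi.
rewrite /gauss [in RHS](reindex_inj (mulfI c0)) mulr_sumr; apply: eq_bigr => x _ /=.
by rewrite chiM !mulrA -expr2 chi_sqr c0 mul1r.
Qed.

Lemma gauss_sqr : gauss ^+ 2 = chi (-1) * q.
Proof.
rewrite expr2 {2}/gauss mulr_sumr.
transitivity (\sum_y chi y * \sum_x psi ((y + 1) * x)).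
  transitivity (\sum_x \sum_y chi y * psi ((y + 1) * x)).
    apply: eq_bigr => x _; rewrite mulrA (mulrC gauss) -gauss_twist mulr_suml.
    by apply: eq_bigr => y _; rewrite -mulrA -psiD; congr (_ * psi _); ring.
  by rewrite exchange_big /=; apply: eq_bigr => y _; rewrite mulr_sumr.
rewrite -(sum_if_eq (-1) (fun y => chi y * q)); apply: eq_bigr => y _.
by rewrite sum_psi addr_eq0 mulrCA.
Qed.

Lemma gauss_neq0 : gauss != 0.
Proof.
rewrite -sqrf_eq0 gauss_sqr mulf_neq0 ?q_neq0 // -sqrf_eq0 chi_sqr.
by rewrite oppr_eq0 oner_neq0 oner_neq0.
Qed.

Definition lin (d e f x y z : F) := d * x + e * y + f * z.
Definition cub (d e f x y z : F) := d * x ^+ 3 + e * y ^+ 3 + f * z ^+ 3.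

Lemma exchange_big3 (G : F -> F -> F -> F -> algC) :
  \sum_l \sum_x \sum_y \sum_z G l x y z = \sum_x \sum_y \sum_z \sum_l G l x y z.
Proof.
rewrite exchange_big; apply: eq_bigr => x _ /=.
rewrite exchange_big; apply: eq_bigr => y _ /=.
by rewrite exchange_big; apply: eq_bigr => z _ /=.
Qed.

Lemma reindex_scale3 l (G : F -> F -> F -> algC) : l != 0 ->
  \sum_x \sum_y \sum_z G (l * x) (l * y) (l * z) = \sum_x \sum_y \sum_z G x y z.
Proof.
move=> l0; rewrite [RHS](reindex_inj (mulfI l0)); apply: eq_bigr => x _ /=.
rewrite [RHS](reindex_inj (mulfI l0)); apply: eq_bigr => y _ /=.
by rewrite [RHS](reindex_inj (mulfI l0)).
Qed.

Lemma sum_psi_cube c :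
  \sum_l (l != 0)%:R * psi (l ^+ 3 * c) = (c == 0)%:R * q - 1.
Proof.
have -> : (c == 0)%:R * q = \sum_l psi (l ^+ 3 * c).
  rewrite -sum_psi (reindex_inj cube_inj).
  by apply: eq_bigr => l _; rewrite mulrC.
rewrite (bigD1 0) //= eqxx mul0r add0r [in RHS](bigD1 0) //= expr0n mul0r psi0.
by rewrite addrAC subrr add0r; apply: eq_bigr => l ->; rewrite mul1r.
Qed.

(** The plane [lin = 0] is stable under scaling, so the sum is unchanged when
    [cub] is replaced by [l ^ 3 * cub] for any nonzero [l].  Averaging over [l]
    leaves [q - 1] where [cub] vanishes and [-1] elsewhere, because [l ^ 3] runs
    over all nonzero elements; the plane has [q ^ 2] points. *)
Lemma homogeneous_exp_sum d e f : d != 0 ->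
  (q - 1) * \sum_x \sum_y \sum_z (lin d e f x y z == 0)%:R * psi (cub d e f x y z)
  = q * \sum_x \sum_y \sum_z (lin d e f x y z == 0)%:R * (cub d e f x y z == 0)%:R
    - q ^+ 2.
Proof.
move=> d0.
have count : \sum_x \sum_y \sum_z (lin d e f x y z == 0)%:R = q ^+ 2.
  transitivity (\sum_(y : F) \sum_(z : F) (1 : algC)); last first.
    by rewrite !sum_const mulr1.
  rewrite exchange_big; apply: eq_bigr => y _ /=.
  rewrite exchange_big; apply: eq_bigr => z _ /=.
  rewrite -[RHS](sum_if_eq (- (e * y + f * z) / d) (fun=> 1)); apply: eq_bigr => x _.
  rewrite mulr1 /lin -addrA addr_eq0 -[x in RHS](mulKf d0) (mulrC d^-1).
  by rewrite (inj_eq (mulIf _)) // invr_eq0.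
rewrite -sum_indicator_neq0 mulr_suml.
transitivity (\sum_l \sum_x \sum_y \sum_z
   (lin d e f x y z == 0)%:R * ((l != 0)%:R * psi (l ^+ 3 * cub d e f x y z))).
  apply: eq_bigr => l _; rewrite mulr_sumr.
  have [->|l0] := eqVneq l 0.
    rewrite !big1 // => x _; rewrite ?mul0r // big1 // => y _.
    by rewrite big1 // => z _; rewrite mul0r mulr0.
  rewrite -mulr_sumr mul1r -(reindex_scale3 _ l0); apply: eq_bigr => x _.
  apply: eq_bigr => y _; apply: eq_bigr => z _.
  have -> : lin d e f (l * x) (l * y) (l * z) = l * lin d e f x y z by rewrite /lin; ring.
  rewrite mulf_eq0 (negPf l0) mul1r; congr (_ * psi _).
  by rewrite /cub; ring.
rewrite exchange_big3 -count mulr_sumr -sumrB; apply: eq_bigr => x _.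
rewrite mulr_sumr -sumrB; apply: eq_bigr => y _.
rewrite mulr_sumr -sumrB; apply: eq_bigr => z _.
by rewrite -mulr_sumr sum_psi_cube; ring.
Qed.

Variable b : F.
Hypothesis b_neq0 : b != 0.

Definition weight (d e f : F) := chi d * chi e * chi f * psi (b * (d + e + f)).

(** The part of the third moment attached to [(x, y, z)] once the additive
    characters have been summed out; the roles of [(d, e, f)] and [(x, y, z)]
    are now exchanged. *)
Definition dual_sum (x y z : F) := \sum_d \sum_e \sum_f
  weight d e f * ((lin d e f x y z == 0)%:R * (cub d e f x y z == 0)%:R).

Lemma cube_sum (a : F -> algC) :
  (\sum_x a x) ^+ 3 = \sum_x \sum_y \sum_z a x * a y * a z.
Proof.
rewrite !exprS expr0 mulr1 mulr_suml; apply: eq_bigr => x _.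
rewrite mulr_suml mulr_sumr; apply: eq_bigr => y _.
by rewrite !mulr_sumr; apply: eq_bigr => z _; rewrite mulrA.
Qed.

Lemma sum_weight : \sum_d \sum_e \sum_f weight d e f = (chi b * gauss) ^+ 3.
Proof.
rewrite -gauss_twist cube_sum; apply: eq_bigr => d _; apply: eq_bigr => e _.
apply: eq_bigr => f _; rewrite /weight !mulrDr !psiD; ring.
Qed.

Definition trace_sum t := \sum_x chi (x ^+ 3 + t * x + b).

(** Each factor [gauss * chi (x ^ 3 + t * x + b)] is expanded by [gauss_twist];
    the sum over [t] then imposes the vanishing of [lin]. *)
Lemma gauss_cube_moment :
  gauss ^+ 3 * \sum_t trace_sum t ^+ 3 =
  q * \sum_d \sum_e \sum_f weight d e f *
    \sum_x \sum_y \sum_z (lin d e f x y z == 0)%:R * psi (cub d e f x y z).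
Proof.
pose h d t := \sum_x psi (d * x ^+ 3 + t * (d * x)).
have expand t : gauss * trace_sum t = \sum_d chi d * psi (b * d) * h d t.
  rewrite mulr_sumr; under eq_bigr => x _ do rewrite mulrC -gauss_twist.
  rewrite exchange_big; apply: eq_bigr => d _ /=; rewrite mulr_sumr.
  by apply: eq_bigr => x _; rewrite -mulrA -psiD; congr (_ * psi _); ring.
transitivity (\sum_t \sum_d \sum_e \sum_f weight d e f * (h d t * h e t * h f t)).
  rewrite mulr_sumr; apply: eq_bigr => t _; rewrite -exprMn expand cube_sum.
  apply: eq_bigr => d _; apply: eq_bigr => e _; apply: eq_bigr => f _.
  by rewrite /weight !mulrDr !psiD; ring.
rewrite exchange_big3 mulr_sumr; apply: eq_bigr => d _.
rewrite mulr_sumr; apply: eq_bigr => e _; rewrite mulr_sumr; apply: eq_bigr => f _.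
rewrite -mulr_sumr mulrCA; congr (_ * _).
transitivity (\sum_t \sum_x \sum_y \sum_z
    psi (cub d e f x y z) * psi (lin d e f x y z * t)).
  apply: eq_bigr => t _; rewrite /h mulr_suml mulr_suml; apply: eq_bigr => x _.
  rewrite -mulrA mulr_suml mulr_sumr; apply: eq_bigr => y _.
  rewrite !mulr_sumr; apply: eq_bigr => z _; rewrite -!psiD; congr psi.
  by rewrite /lin /cub; ring.
rewrite exchange_big3 mulr_sumr; apply: eq_bigr => x _.
rewrite mulr_sumr; apply: eq_bigr => y _; rewrite mulr_sumr; apply: eq_bigr => z _.
by rewrite -mulr_sumr sum_psi; ring.
Qed.

Lemma exchange_big33 (G : F -> F -> F -> F -> F -> F -> algC) :
  \sum_d \sum_e \sum_f \sum_x \sum_y \sum_z G d e f x y z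
  = \sum_x \sum_y \sum_z \sum_d \sum_e \sum_f G d e f x y z.
Proof.
rewrite -[RHS]exchange_big3; apply: eq_bigr => d _.
rewrite -[RHS]exchange_big3; apply: eq_bigr => e _.
by rewrite -[RHS]exchange_big3.
Qed.

Lemma moment_dual_sum :
  (q - 1) * (gauss ^+ 3 * \sum_t trace_sum t ^+ 3) =
  q ^+ 2 * \sum_x \sum_y \sum_z dual_sum x y z - q ^+ 3 * (chi b * gauss) ^+ 3.
Proof.
rewrite gauss_cube_moment -sum_weight -exchange_big33 !mulr_sumr -sumrB.
apply: eq_bigr => d _; rewrite !mulr_sumr -sumrB; apply: eq_bigr => e _.
rewrite !mulr_sumr -sumrB; apply: eq_bigr => f _.
under [X in _ = _ * X - _]eq_bigr => x _ do
  (under eq_bigr => y _ do rewrite -mulr_sumr; rewrite -mulr_sumr).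
rewrite -mulr_sumr.
(* Averaging needs a nonzero linear form; the weight vanishes for d = 0. *)
have [->|d0] := eqVneq d 0; first by rewrite /weight chi0 !(mul0r, mulr0) subr0.
transitivity (q * weight d e f * ((q - 1) *
  \sum_x \sum_y \sum_z (lin d e f x y z == 0)%:R * psi (cub d e f x y z))).
  by ring.
by rewrite homogeneous_exp_sum //; ring.
Qed.

Lemma dual_sumC12 x y z : dual_sum x y z = dual_sum y x z.
Proof.
rewrite /dual_sum exchange_big; apply: eq_bigr => e _; apply: eq_bigr => d _.
apply: eq_bigr => f _; congr (_ * (_ * _)).
- by rewrite /weight [d + e]addrC (mulrC (chi d)).
- by congr (_ == _)%:R; rewrite /lin; ring.
- by congr (_ == _)%:R; rewrite /cub; ring.
Qed.

Lemma dual_sumC23 x y z : dual_sum x y z = dual_sum x z y.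
Proof.
rewrite /dual_sum; apply: eq_bigr => d _; rewrite exchange_big.
apply: eq_bigr => f _; apply: eq_bigr => e _; congr (_ * (_ * _)).
- by rewrite /weight [d + e + f]addrAC -!mulrA (mulrCA (chi e)).
- by congr (_ == _)%:R; rewrite /lin; ring.
- by congr (_ == _)%:R; rewrite /cub; ring.
Qed.

Lemma dual_sum_scale l x y z : l != 0 ->
  dual_sum (l * x) (l * y) (l * z) = dual_sum x y z.
Proof.
move=> l0; apply: eq_bigr => d _; apply: eq_bigr => e _; apply: eq_bigr => f _.
have -> : lin d e f (l * x) (l * y) (l * z) = l * lin d e f x y z by rewrite /lin; ring.
have -> : cub d e f (l * x) (l * y) (l * z) = l ^+ 3 * cub d e f x y z.
  by rewrite /cub; ring.
by rewrite mulf_eq0 (negPf l0) mulf_eq0 expf_eq0 (negPf l0).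
Qed.

(** * Independent forms *)

(** By Cramer's rule the common kernel is the line of multiples [k v] of the
    cross product [v]; there [chi d * chi e * chi f] is
    [chi k * chi (v1 * v2 * v3)], so a Gauss sum in [k] remains. *)
Lemma dual_sum_cross12 x y z : cross x y != 0 ->
  dual_sum x y z = chi (cross_prod x y z) * (chi b * gauss).
Proof.
move=> v0.
set v1 := cross y z; set v2 := cross z x; set v3 := cross x y.
transitivity (\sum_d \sum_e \sum_k
   (d == v1 * k)%:R * ((e == v2 * k)%:R * weight d e (v3 * k))).
  apply: eq_bigr => d _; apply: eq_bigr => e _.
  rewrite (reindex_inj (mulfI v0)); apply: eq_bigr => k _ /=.
  rewrite -/v3 [RHS]mulrA [RHS]mulrC -!natrM !mulnb; congr (_ * (nat_of_bool _)%:R).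
  apply/andP/andP => -[/eqP e1 /eqP e2]; last first.
    by rewrite /lin /cub e1 e2 /v1 /v2 /v3 /cross; split; apply/eqP; ring.
  (* Eliminate e, then d, between the two linear equations. *)
  split; rewrite -(inj_eq (mulfI v0)) -subr_eq0; apply/eqP.
    transitivity (y ^+ 3 * lin d e (v3 * k) x y z - y * cub d e (v3 * k) x y z).
      by rewrite /lin /cub /v1 /v3 /cross; ring.
    by rewrite e1 e2 !mulr0 subrr.
  transitivity (x * cub d e (v3 * k) x y z - x ^+ 3 * lin d e (v3 * k) x y z).
    by rewrite /lin /cub /v2 /v3 /cross; ring.
  by rewrite e1 e2 !mulr0 subrr.
under eq_bigr => d _ do rewrite exchange_big.
rewrite exchange_big /=.
transitivity (\sum_k weight (v1 * k) (v2 * k) (v3 * k)).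
  apply: eq_bigr => k _.
  under eq_bigr => d _ do rewrite -mulr_sumr.
  by rewrite !sum_if_eq.
transitivity (chi (v1 * v2 * v3) * \sum_k chi k * psi (b * (v1 + v2 + v3) * k)).
  rewrite mulr_sumr; apply: eq_bigr => k _.
  rewrite /weight !(chiM _ k) (chiM (v1 * v2)) (chiM v1).
  have [->|k0] := eqVneq k 0; first by rewrite chi0 !(mulr0, mul0r).
  have ck : chi k ^+ 2 = 1 by rewrite chi_sqr k0.
  rewrite (_ : b * (v1 * k + v2 * k + v3 * k) = b * (v1 + v2 + v3) * k); last by ring.
  transitivity (chi v1 * chi v2 * chi v3 * (chi k ^+ 2 * chi k *
     psi (b * (v1 + v2 + v3) * k))); first by ring.
  by rewrite ck mul1r.
rewrite gauss_twist mulrA -chiM [RHS]mulrA -chiM; congr (chi _ * _).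
by rewrite /cross_prod -/v1 -/v2 -/v3 /v1 /v2 /v3 /cross; ring.
Qed.

Lemma cross_prodC12 x y z : cross_prod x y z = cross_prod y x z.
Proof. by rewrite /cross_prod /cross; ring. Qed.

Lemma cross_prodC23 x y z : cross_prod x y z = cross_prod x z y.
Proof. by rewrite /cross_prod /cross; ring. Qed.

Lemma dual_sum_cross x y z : [|| cross y z != 0, cross z x != 0 | cross x y != 0] ->
  dual_sum x y z = chi (cross_prod x y z) * (chi b * gauss).
Proof.
have crossC u v : (cross u v != 0) = (cross v u != 0).
  by have -> : cross u v = - cross v u; [rewrite /cross; ring | rewrite oppr_eq0].
case/or3P => v0; last exact: dual_sum_cross12.
- rewrite dual_sumC12 dual_sumC23 dual_sumC12.
  rewrite cross_prodC12 cross_prodC23 cross_prodC12.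
  by rewrite dual_sum_cross12 // crossC.
- by rewrite dual_sumC23 cross_prodC23 dual_sum_cross12 // crossC.
Qed.

(** * Dependent forms *)

Definition degenerate x y z := [&& cross y z == 0, cross z x == 0 & cross x y == 0].

(** Every nonzero triple is uniquely a nonzero multiple of one whose first
    nonzero entry is 1. *)
Lemma homogeneous_sum (H : F -> F -> F -> algC) :
  (forall l x y z, l != 0 -> H (l * x) (l * y) (l * z) = H x y z) ->
  \sum_x \sum_y \sum_z H x y z
  = H 0 0 0 + (q - 1) * (H 0 0 1 + \sum_z H 0 1 z + \sum_y \sum_z H 1 y z).
Proof.
move=> Hl; rewrite -sum_indicator_neq0.
have split0 (f : F -> algC) : \sum_x f x = f 0 + \sum_x (x != 0)%:R * f x.
  rewrite (bigD1 0) //= [in RHS](bigD1 0) //= eqxx mul0r add0r; congr (_ + _).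
  by apply: eq_bigr => x ->; rewrite mul1r.
have /= -> := split0 (fun x => \sum_y \sum_z H x y z).
have /= -> := split0 (fun y => \sum_z H 0 y z).
rewrite (split0 (H 0 0)) -!addrA; congr (_ + _).
rewrite !mulrDr !mulr_suml; congr (_ + (_ + _)); apply: eq_bigr => l _.
- by have [->|l0] := eqVneq l 0; rewrite ?mul0r // -(Hl l 0 0 1) // !mulr0 mulr1.
- have [->|l0] := eqVneq l 0; rewrite ?mul0r //; congr (_ * _).
  rewrite (reindex_inj (mulfI l0)); apply: eq_bigr => z _ /=.
  by rewrite -(Hl l 0 1 z) // mulr0 mulr1.
- have [->|l0] := eqVneq l 0; rewrite ?mul0r //; congr (_ * _).
  rewrite (reindex_inj (mulfI l0)); apply: eq_bigr => y _ /=.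
  rewrite (reindex_inj (mulfI l0)); apply: eq_bigr => z _ /=.
  by rewrite -(Hl l 1 y z) // mulr1.
Qed.

Lemma sum_root_cube_sub (f : F -> algC) :
  \sum_x (x * (x ^+ 2 - 1) == 0)%:R * f x = f 0 + f 1 + f (-1).
Proof.
rewrite -(sum_if_eq 0 f) -(sum_if_eq 1 f) -(sum_if_eq (-1) f) -!big_split /=.
apply: eq_bigr => x _; rewrite mulf_eq0 subr_eq0 sqrf_eq1.
have [->|x0] /= := eqVneq x 0.
  by rewrite ![0 == _]eq_sym oppr_eq0 (negPf (oner_neq0 _)) /=; ring.
by have [->|x1] /= := eqVneq x 1; rewrite ?(negPf (neq_opp (oner_neq0 _))) /=; ring.
Qed.

Lemma sum_degenerate :
  \sum_x \sum_y \sum_z (degenerate x y z)%:R * dual_sum x y z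
  = dual_sum 0 0 0 + (q - 1) * (dual_sum 0 0 1
    + (dual_sum 0 1 0 + dual_sum 0 1 1 + dual_sum 0 1 (-1))
    + ((dual_sum 1 0 0 + dual_sum 1 0 1 + dual_sum 1 0 (-1))
    + (dual_sum 1 1 0 + dual_sum 1 1 1 + dual_sum 1 1 (-1))
    + (dual_sum 1 (-1) 0 + dual_sum 1 (-1) 1 + dual_sum 1 (-1) (-1)))).
Proof.
have cross_scale l u v : l != 0 -> (cross (l * u) (l * v) == 0) = (cross u v == 0).
  move=> l0; have -> : cross (l * u) (l * v) = l ^+ 4 * cross u v by rewrite /cross; ring.
  by rewrite mulf_eq0 expf_eq0 (negPf l0).
rewrite homogeneous_sum; last first.
  by move=> l x y z l0; rewrite dual_sum_scale // /degenerate !cross_scale.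
have c0 u : (cross 0 u == 0) = true by rewrite /cross !mul0r eqxx.
have c0' u : (cross u 0 == 0) = true by rewrite /cross mulr0 mul0r eqxx.
have c1 u : (cross 1 u == 0) = (u * (u ^+ 2 - 1) == 0) by rewrite /cross mul1r expr1n.
have c1' u : (cross u 1 == 0) = (u * (u ^+ 2 - 1) == 0).
  have -> : cross u 1 = - (u * (u ^+ 2 - 1)) by rewrite /cross; ring.
  by rewrite oppr_eq0.
rewrite /degenerate !(c0, c0') /= !mul1r; congr (_ + _ * (_ + _ + _)).
  rewrite -sum_root_cube_sub; apply: eq_bigr => z _.
  by rewrite ?c0 c0' c1 ?andbT.
rewrite -(sum_root_cube_sub (fun y => dual_sum 1 y 0 + dual_sum 1 y 1 + dual_sum 1 y (-1))).
apply: eq_bigr => y _.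
rewrite -(sum_root_cube_sub (dual_sum 1 y)) mulr_sumr; apply: eq_bigr => z _.
rewrite c1 c1' mulrA -natrM mulnb andbC -andbA andbCA andbA.
have [/eqP zz|] /= := boolP (z * _ == 0); rewrite ?andbF ?andbT //.
have [/eqP yy|] /= := boolP (y * _ == 0); rewrite ?andbF ?andbT //.
suff -> : cross y z = 0 by rewrite eqxx.
have -> : cross y z = y * (z * (z ^+ 2 - 1)) - z * (y * (y ^+ 2 - 1)) by rewrite /cross; ring.
by rewrite zz yy !mulr0 subrr.
Qed.

(** On entries equal to their own cube the forms [lin] and [cub] coincide, and
    the single equation that remains determines [d]. *)
Lemma dual_sum_cube_fixed y z : y ^+ 3 = y -> z ^+ 3 = z ->
  dual_sum 1 y z = \sum_e \sum_f weight (- (e * y + f * z)) e f.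
Proof.
move=> yy zz; rewrite /dual_sum exchange_big; apply: eq_bigr => e _ /=.
rewrite exchange_big; apply: eq_bigr => f _ /=.
rewrite -[RHS](sum_if_eq _ (fun d => weight d e f)); apply: eq_bigr => d _.
rewrite /cub /lin expr1n yy zz mulr1 -addrA addr_eq0 mulrC -natrM mulnb andbb.
by [].
Qed.

Let cube0 : 0 ^+ 3 = 0 :> F. Proof. exact: expr0n. Qed.
Let cube1 : 1 ^+ 3 = 1 :> F. Proof. exact: expr1n. Qed.
Let cubeN1 : (-1) ^+ 3 = -1 :> F. Proof. by ring. Qed.

Lemma dual_sum_000 : dual_sum 0 0 0 = (chi b * gauss) ^+ 3.
Proof.
rewrite -sum_weight; apply: eq_bigr => d _; apply: eq_bigr => e _.
apply: eq_bigr => f _; rewrite /lin /cub cube0 !mulr0 !addr0 eqxx.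
by rewrite !mulr1.
Qed.

Lemma dual_sum_100 : dual_sum 1 0 0 = 0.
Proof.
rewrite dual_sum_cube_fixed //; apply: big1 => e _; apply: big1 => f _.
by rewrite /weight !mulr0 addr0 oppr0 chi0 !mul0r.
Qed.

Lemma dual_sum_110 : dual_sum 1 1 0 = chi (-1) * (q - 1) * (chi b * gauss).
Proof.
rewrite dual_sum_cube_fixed // -gauss_twist -sum_indicator_neq0 -mulrA.
rewrite mulr_suml mulr_sumr.
apply: eq_bigr => e _; rewrite !mulr_sumr; apply: eq_bigr => f _.
rewrite /weight mulr0 addr0 mulr1 addNr add0r -(mulN1r e) chiM -chi_sqr.
by ring.
Qed.

Lemma dual_sum_1N0 : dual_sum 1 (-1) 0 = - (chi b * gauss).
Proof.
rewrite dual_sum_cube_fixed // -gauss_twist.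
have sum_psi_nz : \sum_e (e != 0)%:R * psi (b * 2%:R * e) = -1.
  have := sum_psi (b * 2%:R); rewrite mulf_eq0 (negPf b_neq0) (negPf two_neq0) mul0r.
  rewrite (bigD1 0) //= mulr0 psi0 => /eqP; rewrite addrC addr_eq0 => /eqP <-.
  rewrite (bigD1 0) //= eqxx mul0r add0r.
  by apply: eq_bigr => e ->; rewrite mul1r.
rewrite -[RHS]mulN1r -sum_psi_nz mulr_suml.
apply: eq_bigr => e _; rewrite mulr_sumr; apply: eq_bigr => f _.
rewrite /weight mulr0 addr0 mulrN1 opprK -chi_sqr.
rewrite (_ : b * (e + e + f) = b * 2%:R * e + b * f) ?psiD; last by ring.
by ring.
Qed.

(** Here [d + e + f = 0] makes the additive character trivial, and
    [chi d * chi e * chi f] changes sign when [(d, e, f)] is scaled by a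
    nonsquare, so the sum over this plane has to vanish. *)
Lemma dual_sum_111 : dual_sum 1 1 1 = 0.
Proof.
rewrite dual_sum_cube_fixed //.
transitivity (\sum_e chi (-1) * chi e * \sum_f chi f * chi (f + e)).
  apply: eq_bigr => e _; rewrite mulr_sumr; apply: eq_bigr => f _.
  rewrite /weight !mulr1 -addrA addNr mulr0 psi0 -(mulN1r (e + f)) chiM addrC.
  by ring.
under eq_bigr => e _ do rewrite sum_chi_shift.
transitivity (\sum_e ((e == 0)%:R * (chi (-1) * chi e * q) - chi (-1) * chi e)).
  by apply: eq_bigr => e _; ring.
rewrite sumrB (sum_if_eq 0 (fun e => chi (-1) * chi e * q)) -mulr_sumr sum_chi.
by rewrite chi0; ring.
Qed.

(** The equation is [f = d + e], and for each nonzero [f] the sum of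
    [chi e * chi (f - e)] is [- chi (-1)]; the Gauss sum in [f] is twisted by
    [2 b]. *)
Lemma dual_sum_11N : dual_sum 1 1 (-1) = - chi (- 2%:R) * (chi b * gauss).
Proof.
rewrite dual_sum_cube_fixed // exchange_big /=.
transitivity (\sum_f chi f * psi (2%:R * b * f) * \sum_e chi e * chi (f - e)).
  apply: eq_bigr => f _; rewrite mulr_sumr; apply: eq_bigr => e _.
  rewrite /weight mulr1 mulrN1 opprB.
  by rewrite (_ : b * (f - e + e + f) = 2%:R * b * f); ring.
under eq_bigr => f _ do rewrite sum_chi_reflect.
transitivity (\sum_f ((f == 0)%:R * (chi f * psi (2%:R * b * f) * (chi (-1) * q))
   - chi (-1) * (chi f * psi (2%:R * b * f)))).
  by apply: eq_bigr => f _; ring.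
rewrite sumrB (sum_if_eq 0 (fun f => chi f * psi (2%:R * b * f) * (chi (-1) * q))).
by rewrite chi0 -mulr_sumr gauss_twist -(mulN1r 2%:R) !chiM; ring.
Qed.

(** The thirteen degenerate directions reduce to [(1, 0, 0)], [(1, 1, 0)],
    [(1, -1, 0)], [(1, 1, 1)] and [(1, 1, -1)] by permutations and sign. *)
Lemma sum_dual_sum :
  \sum_x \sum_y \sum_z dual_sum x y z = (chi b * gauss) ^+ 3
  + (q - 1) * (q * chi 2%:R + 3%:R * chi (-1) * q - 2%:R * chi 2%:R) * (chi b * gauss).
Proof.
have -> : \sum_x \sum_y \sum_z dual_sum x y z =
    (\sum_x \sum_y \sum_z chi (cross_prod x y z)) * (chi b * gauss)
    + \sum_x \sum_y \sum_z (degenerate x y z)%:R * dual_sum x y z.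
  rewrite mulr_suml -big_split; apply: eq_bigr => x _ /=.
  rewrite mulr_suml -big_split; apply: eq_bigr => y _ /=.
  rewrite mulr_suml -big_split; apply: eq_bigr => z _ /=.
  have [/and3P[/eqP v1 _ _]|nd] := boolP (degenerate x y z).
    by rewrite /cross_prod v1 !mul0r chi0 mul0r add0r mul1r.
  rewrite dual_sum_cross ?mul0r ?addr0 //.
  by move: nd; rewrite /degenerate !negb_and.
rewrite sum_chi_cross sum_degenerate.
have E001 : dual_sum 0 0 1 = 0 by rewrite dual_sumC23 dual_sumC12 dual_sum_100.
have E010 : dual_sum 0 1 0 = 0 by rewrite dual_sumC12 dual_sum_100.
have E011 : dual_sum 0 1 1 = dual_sum 1 1 0 by rewrite dual_sumC12 dual_sumC23.
have E01N : dual_sum 0 1 (-1) = dual_sum 1 (-1) 0 by rewrite dual_sumC12 dual_sumC23.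
have E101 : dual_sum 1 0 1 = dual_sum 1 1 0 by rewrite dual_sumC23.
have E10N : dual_sum 1 0 (-1) = dual_sum 1 (-1) 0 by rewrite dual_sumC23.
have E1N1 : dual_sum 1 (-1) 1 = dual_sum 1 1 (-1) by rewrite dual_sumC23.
have E1NN : dual_sum 1 (-1) (-1) = dual_sum 1 1 (-1).
  have N1 : -1 != 0 :> F by rewrite oppr_eq0 oner_neq0.
  by rewrite -(dual_sum_scale _ _ _ N1) mulrNN !mulr1 dual_sumC12 dual_sumC23.
rewrite E001 E010 E011 E01N E101 E10N E1N1 E1NN.
rewrite dual_sum_000 dual_sum_100 dual_sum_110.
rewrite dual_sum_1N0 dual_sum_111 dual_sum_11N.
by ring.
Qed.

(** The moment was multiplied by [gauss ^ 3] and, when averaging over scalings,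
    by [q - 1]; both are nonzero, and [gauss ^ 2] is [chi (-1) * q]. *)
Lemma third_moment :
  \sum_t trace_sum t ^+ 3 = chi b * q * (2%:R * q + chi (- 2%:R) * (q - 2%:R)).
Proof.
have q1 : q - 1 != 0.
  rewrite subr_eq0 -[1]/(1%:R) eqr_nat neq_ltn; apply/orP; right.
  by apply/card_gt1P; exists 0, 1; rewrite !inE eq_sym oner_neq0.
have G3 : gauss ^+ 3 != 0 by rewrite expf_eq0 /= gauss_neq0.
apply: (mulfI G3); apply: (mulfI q1).
rewrite moment_dual_sum sum_dual_sum.
have b1 : chi b ^+ 3 = chi b by rewrite exprS chi_sqr b_neq0 mulr1.
have s1 : chi (-1) ^+ 2 = 1 by rewrite chi_sqr oppr_eq0 oner_neq0.
have G1 : gauss ^+ 3 = gauss * (chi (-1) * q) by rewrite exprS gauss_sqr.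
have -> : chi (- 2%:R) = chi (-1) * chi 2%:R by rewrite -chiM mulN1r.
rewrite exprMn b1 G1.
set s := chi (-1) in s1 *; set t := chi 2%:R.
transitivity ((q - 1) * (gauss * chi b * q ^+ 2) *
   (t * q - 2%:R * t + 2%:R * s * q)); first by ring.
transitivity ((q - 1) * (gauss * chi b * q ^+ 2) *
   (s ^+ 2 * (t * (q - 2%:R)) + 2%:R * s * q)); last by ring.
by rewrite s1; ring.
Qed.

End CubicFamily.

(** * Prime fields *)

Lemma exists_additive_character (p : nat) : prime p ->
  exists2 psi : 'F_p -> algC, {morph psi : x y / x + y >-> x * y} &
    forall c, \sum_x psi (c * x) = (c == 0)%:R * #|{: 'F_p}|%:R.
Proof.
move=> p_pr; have [w w_prim] := C_prim_root_exists (prime_gt0 p_pr).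
pose psi (x : 'F_p) := w ^+ (x : nat).
have psiD : {morph psi : x y / x + y >-> x * y}.
  move=> x y; rewrite /psi -exprD -[RHS](prim_expr_mod w_prim) /=.
  by congr (w ^+ (_ %% _)); exact: Fp_cast.
have psi0 : psi 0 = 1 by [].
exists psi => // c; have [->|c0] := eqVneq c 0.
  under eq_bigr => x _ do rewrite mul0r psi0.
  by rewrite sumr_const mul1r.
rewrite mul0r; set S := \sum_x _.
have psic : psi c != 1.
  rewrite /psi -(prim_order_dvd w_prim); apply: contra c0 => pc.
  by rewrite -[c]natr_Zp -(dvdn_pcharf (pchar_Fp p_pr)).
have : psi c * S = S.
  rewrite mulr_sumr [RHS](reindex_inj (addrI 1)); apply: eq_bigr => x _ /=.
  by rewrite -psiD mulrDr mulr1.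
move/eqP; rewrite -subr_eq0 -{2}[S]mul1r -mulrBl mulf_eq0 subr_eq0 (negPf psic) /=.
by move/eqP.
Qed.

(** If [q = 3 m + 2] then [3 (2 m + 1)] is [2 q - 1], which is 1 modulo [q - 1],
    so raising to the power [2 m + 1] inverts cubing. *)
Lemma cube_inj_finField (F : finFieldType) : (#|F| %% 3 = 2)%N ->
  injective (fun x : F => x ^+ 3).
Proof.
move=> F3; have F0 : (0 < #|F|)%N by apply/card_gt0P; exists 0.
apply: (can_inj (g := fun x => x ^+ (#|F| %/ 3 * 2 + 1))) => x.
rewrite -exprM.
have -> : (3 * (#|F| %/ 3 * 2 + 1) = #|F| + #|F|.-1)%N.
  by have := divn_eq #|F| 3; rewrite F3; lia.
by rewrite exprD expf_card -exprS prednK // expf_card.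
Qed.

Lemma chi_legendre (p : nat) (x : 'F_p) : (legendre x)%:~R = chi x.
Proof. by rewrite /legendre /chi; do 2?case: ifP => _. Qed.

(** Over each abscissa [x] the curve has [1 + chi (x ^ 3 + t * x + b)] affine
    points. *)
Lemma frob_trace_sum (p : nat) (t b : 'F_p) : prime p -> 2%:R != 0 :> 'F_p ->
  (frob_trace t b)%:~R = - trace_sum b t.
Proof.
move=> p_pr two0; rewrite /frob_trace.
have -> : curve_points t b = None |: (Some @:
    [set P : 'F_p * 'F_p | P.2 ^+ 2 == P.1 ^+ 3 + t * P.1 + b]).
  apply/setP => -[[x y]|]; rewrite !inE //=.
    by rewrite mem_imset ?inE //; exact: Some_inj.
set B := [set P | _]; have noNone : None \notin Some @: B by apply/imsetP => -[].
rewrite cardsU1 noNone card_imset; last exact: Some_inj.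
have cardB : #|B|%:R = p%:R + trace_sum b t :> algC.
  have -> : p%:R = #|{: 'F_p}|%:R :> algC by rewrite card_Fp.
  rewrite -[X in X + _]mulr1 -sum_const -big_split /=.
  under eq_bigr => x _ do rewrite -(sum_sqrt two0).
  rewrite pair_bigA /= -sum1_card natr_sum big_mkcond; apply: eq_bigr => P _.
  by rewrite inE; case: (_ == _).
rewrite rmorphB rmorphD /= -!pmulrn natrD cardB; ring.
Qed.

Theorem theorem6 (p : nat) (p_prime : prime p) (p_mod6 : (p = 5 %[mod 6])%N)
    (b : 'F_p) (b_neq0 : b != 0) :
  \sum_(t : 'F_p) frob_trace t b ^+ 3
  = - p%:Z * ((p%:Z - 2) * legendre (- 2%:R : 'F_p) + 2 * p%:Z) * legendre b.
Proof.
have card_p := card_Fp p_prime.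
have nat_neq0 n : ~~ (p %| n)%N -> n%:R != 0 :> 'F_p.
  by rewrite (dvdn_pcharf (pchar_Fp p_prime)).
have two0 : 2%:R != 0 :> 'F_p.
  apply: nat_neq0; rewrite dvdn_prime2 //; apply/eqP => p2.
  by rewrite p2 in p_mod6.
have three0 : 3%:R != 0 :> 'F_p.
  apply: nat_neq0; rewrite dvdn_prime2 //; apply/eqP => p3.
  by rewrite p3 in p_mod6.
have cubeI : injective (fun x : 'F_p => x ^+ 3).
  by apply: cube_inj_finField; rewrite card_p; move: p_mod6; lia.
have [psi psiD sum_psi] := exists_additive_character p_prime.
have := third_moment two0 three0 cubeI psiD sum_psi b_neq0.
rewrite card_p => moment; apply: (@intr_inj algC).
rewrite rmorph_sum /=; under eq_bigr => t _ do rewrite rmorphXn /= frob_trace_sum //.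
transitivity (- \sum_t trace_sum b t ^+ 3).
  by rewrite -sumrN; apply: eq_bigr => t _; ring.
rewrite moment !(rmorphM, rmorphN, rmorphD, rmorphB) /= !chi_legendre.
rewrite -!pmulrn; ring.
Qed.
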